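(* Let $\mathfrak A$ be an initial chain algebra on a pseudotree. Then its Stone space $K_{\mathfrak A}$ satisfies $\text{free-dim}(K_{\mathfrak A})\le 1$. In particular, $\mathfrak A$ does not contain a free product of an infinite Boolean algebra and an uncountable Boolean algebra; that is, if $\mathfrak B_1$ is an infinite Boolean algebra and $\mathfrak B_2$ is an uncountable Boolean algebra, then no subalgebra of $\mathfrak A$ is isomorphic to the free product $\mathfrak B_1\otimes\mathfrak B_2$.
   Context: A pseudotree is a partially ordered set $(T,\le)$ in which every set $(-\infty,t]=\{s\in T: s\le t\}$ is linearly ordered. The initial chain algebra on a pseudotree $T$ is the algebra of subsets of $T$ generated by the initial chains $(-\infty,t]$, $t\in T$. $K_{\mathfrak A}$ denotes the Stone space of all ultrafilters on $\mathfrak A$. The free product $\otimes$ of Boolean algebras is their coproduct (the Stone space of $\mathfrak B_1\otimes\mathfrak B_2$ is $K_{\mathfrak B_1}\times K_{\mathfrak B_2}$). For a compact space $K$, $\mathrm{FCC}(K)$ denotes the family of all finite covers of $K$ by closed subsets. For finite covers $\mathcal C_1,\mathcal C_2$ of $K$ write $\mathcal C_1\prec\mathcal C_2$ ($\mathcal C_1$ refines $\mathcal C_2$) if every $C_1\in\mathcal C_1$ is contained in some $C_2\in\mathcal C_2$. A family $\mathfrak C\subseteq \mathrm{FCC}(K)$ is topologically cofinal if for every open cover $\mathcal U$ of $K$ there is $\mathcal C\in\mathfrak C$ with $\mathcal C\prec\mathcal U$ (every member of $\mathcal C$ is contained in a member of $\mathcal U$). For $d\in\mathbb N=\{0,1,2,\dots\}$,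 write $\text{free-dim}(K)\le d$ if there are a topologically cofinal family $\mathfrak C\subseteq\mathrm{FCC}(K)$, a constant $M>0$ and a function $\chi:\mathfrak C\to\mathbb N$ such that for every $k\ge 1$, any $\mathcal C_1,\dots,\mathcal C_k\in\mathfrak C$ have a joint refinement $\mathcal C\in\mathrm{FCC}(K)$ (i.e. $\mathcal C\prec\mathcal C_i$ for all $i\le k$) with $|\mathcal C|\le M\big(\chi(\mathcal C_1)+\dots+\chi(\mathcal C_k)\big)^d$ (with $0^0=1$). *)

(* Defs.v *)
From HB Require Import structures.
From mathcomp Require Import all_boot all_order all_algebra.
From mathcomp Require Import finmap.
From mathcomp Require Import all_classical all_reals all_analysis.

Set Implicit Arguments.
Unset Strict Implicit.
Unset Printing Implicit Defensive.
Import Order.TTheory GRing.Theory Num.Theory.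
Import SetOrder.Exports.

Local Open Scope classical_set_scope.

(* Boolean algebras are [ctbDistrLatticeType]s; the degenerate algebra with
   \bot = \top is allowed. *)
Section BooleanAlgebras.
Local Open Scope order_scope.

Definition boolean_hom (dA dB : Order.disp_t) (A : ctbDistrLatticeType dA)
    (B : ctbDistrLatticeType dB) (f : A -> B) : Prop :=
  [/\ f \bot = \bot, f \top = \top,
      {morph f : x y / x `&` y}, {morph f : x y / x `|` y} &
      {morph f : x / ~` x}].

Definition subalgebra (dA : Order.disp_t) (A : ctbDistrLatticeType dA)
    (S : set A) : Prop :=
  [/\ S \bot, S \top,
      forall x y, S x -> S y -> S (x `&` y),
      forall x y, S x -> S y -> S (x `|` y) &
      forall x, S x -> S (~` x)].

Definition isomorphic_to_subalgebra (dP dA : Order.disp_t)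
    (P : ctbDistrLatticeType dP) (A : ctbDistrLatticeType dA)
    (S : set A) : Prop :=
  exists f : P -> A, boolean_hom f /\ set_bij [set: P] S f.

(* (P, i1, i2) is a coproduct of B1 and B2 in the category of Boolean
   algebras; this determines P up to isomorphism. *)
Definition is_free_product (d1 d2 dP : Order.disp_t)
    (B1 : ctbDistrLatticeType d1) (B2 : ctbDistrLatticeType d2)
    (P : ctbDistrLatticeType dP) (i1 : B1 -> P) (i2 : B2 -> P) : Prop :=
  [/\ boolean_hom i1, boolean_hom i2 &
      forall (dC : Order.disp_t) (C : ctbDistrLatticeType dC)
             (f1 : B1 -> C) (f2 : B2 -> C),
        boolean_hom f1 -> boolean_hom f2 ->
        exists! h : P -> C, [/\ boolean_hom h, h \o i1 = f1 & h \o i2 = f2]].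

Definition ultrafilter (dA : Order.disp_t) (A : ctbDistrLatticeType dA)
    (u : set A) : Prop :=
  [/\ u \top, ~ u \bot,
      forall x y, u x -> u y -> u (x `&` y),
      forall x y, x <= y -> u x -> u y &
      forall x, u x \/ u (~` x)].

End BooleanAlgebras.

Section StoneSpace.
Context (dA : Order.disp_t) (A : ctbDistrLatticeType dA).

Definition stone : Type := set_type [set u : set A | ultrafilter u].

HB.instance Definition _ := Choice.on stone.

Definition stone_clopen (a : A) : set stone := [set u | (val u : set A) a].

Lemma stone_cover :
  \bigcup_(V in range stone_clopen) (V : set stone) = setT.
Proof.
rewrite -subTset => u _.
exists (stone_clopen \top%O); first by exists \top%O.
by have /set_mem[] := valP u.
Qed.

Lemma stone_join (V W : set stone) (u : stone) :
  range stone_clopen V -> range stone_clopen W -> V u -> W u ->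
  exists X : set stone, [/\ range stone_clopen X, X u & X `<=` V `&` W].
Proof.
move=> [a _ <-] [b _ <-] ua ub.
exists (stone_clopen (a `&` b)%O); split.
- by exists (a `&` b)%O.
- by have /set_mem[_ _ uI _ _] := valP u; exact: uI.
- move=> v vab; have /set_mem[_ _ _ vle _] := valP v.
  by split; apply: vle vab; [exact: leIl|exact: leIr].
Qed.

(* The topology with base {stone_clopen a | a in A}; the base is indexed by
   itself because [isBaseTopological] wants a pointed index type. *)
HB.instance Definition _ := @isBaseTopological.Build stone (set stone)
  (range stone_clopen) id stone_cover stone_join.

End StoneSpace.

Section InitialChainAlgebra.
Context (dT : Order.disp_t) (T : porderType dT).

Definition pseudotree : Prop :=
  forall t s s' : T, (s <= t)%O -> (s' <= t)%O -> (s >=< s')%O.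

Definition initial_chain (t : T) : set T := [set s | (s <= t)%O].

Definition set_algebra (G : set (set T)) : Prop :=
  [/\ G set0, setC_closed G & setU_closed G].

Definition initial_chain_sets : set (set T) :=
  smallest set_algebra (range initial_chain).

Lemma set_algebra_initial_chain_sets : set_algebra initial_chain_sets.
Proof.
split.
- by move=> G [[]].
- by move=> X XG G GP; have [[_ GC _] _] := GP; apply: GC; exact: XG.
- move=> X Y XG YG G GP; have [[_ _ GU] _] := GP.
  by apply: GU; [exact: XG|exact: YG].
Qed.

Definition initial_chain_algebra : Type := set_type initial_chain_sets.

HB.instance Definition _ := SubChoice.on initial_chain_algebra.

Let mem_ica (X : set T) : initial_chain_sets X -> X \in initial_chain_sets.
Proof. exact: mem_set. Qed.

Let ica_setC (X : set T) :
  X \in initial_chain_sets -> ~` X \in initial_chain_sets.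
Proof.
have [_ GC _] := set_algebra_initial_chain_sets.
by move=> /set_mem XG; apply: mem_ica; exact: GC.
Qed.

Let ica_setU : {in [in initial_chain_sets] &,
  forall X Y : set T, (X `|` Y)%O \in [in initial_chain_sets]}.
Proof.
have [_ _ GU] := set_algebra_initial_chain_sets.
by move=> X Y /set_mem XG /set_mem YG; apply: mem_ica; exact: GU.
Qed.

Let ica_setI : {in [in initial_chain_sets] &,
  forall X Y : set T, (X `&` Y)%O \in [in initial_chain_sets]}.
Proof.
move=> X Y XG YG.
have -> : (X `&` Y)%O = ~` (~` X `|` ~` Y) by rewrite setCU !setCK.
by apply/ica_setC/ica_setU; exact: ica_setC.
Qed.

Let ica_set0 : (\bot%O : set T) \in [in initial_chain_sets].
Proof. by apply: mem_ica; have [] := set_algebra_initial_chain_sets. Qed.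

Let ica_setT : (\top%O : set T) \in [in initial_chain_sets].
Proof.
have -> : (\top%O : set T) = ~` set0 by rewrite setC0.
exact: ica_setC ica_set0.
Qed.

(* The operations are the set-theoretic ones, inherited from [set T]. *)
HB.instance Definition _ :=
  Order.SubChoice_isTBSubLattice.Build set_display (set T)
    (fun X => X \in initial_chain_sets) set_display initial_chain_algebra
    ica_setI ica_setU ica_set0 ica_setT.

Let ica_meetUl : left_distributive
  (@Order.meet _ initial_chain_algebra) (@Order.join _ initial_chain_algebra).
Proof. by move=> X Y Z; apply: val_inj; exact: setIUl. Qed.

HB.instance Definition _ :=
  Order.Lattice_Meet_isDistrLattice.Build set_display initial_chain_algebra
    ica_meetUl.

Definition ica_compl (X : initial_chain_algebra) : initial_chain_algebra :=
  exist _ (~` val X) (ica_setC (valP X)).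

Let ica_joinxC (X : initial_chain_algebra) : (X `|` ica_compl X = \top)%O.
Proof. by apply: val_inj => /=; exact: setUv. Qed.

Let ica_meetxC (X : initial_chain_algebra) : (X `&` ica_compl X = \bot)%O.
Proof. by apply: val_inj => /=; exact: setICr. Qed.

HB.instance Definition _ :=
  Order.TBDistrLattice_hasComplement.Build set_display initial_chain_algebra
    ica_joinxC ica_meetxC.

End InitialChainAlgebra.

Section FreeDimension.
Context (K : topologicalType).
Local Open Scope ring_scope.

Definition FCC : set (set (set K)) :=
  [set C | [/\ finite_set C, \bigcup_(X in C) X = [set: K] &
               forall X, C X -> closed X]].

Definition refines (C D : set (set K)) : Prop :=
  forall X, C X -> exists2 Y, D Y & X `<=` Y.

Definition open_cover (U : set (set K)) : Prop :=
  (forall V, U V -> open V) /\ \bigcup_(V in U) V = [set: K].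

Definition topologically_cofinal (F : set (set (set K))) : Prop :=
  F `<=` FCC /\
  forall U, open_cover U -> exists2 C, F C & refines C U.

(* Only the values of chi on F matter; [0 ^+ 0 = 1] in MathComp. *)
Definition free_dim_le (R : realType) (d : nat) : Prop :=
  exists (F : set (set (set K))) (M : R) (chi : set (set K) -> nat),
    [/\ topologically_cofinal F, 0 < M &
        forall (k : nat) (Cs : 'I_k -> set (set K)),
          (1 <= k)%N -> (forall i, F (Cs i)) ->
          exists C, [/\ FCC C, (forall i, refines C (Cs i)) &
            (#|` fset_set C|)%:R <= M * ((\sum_(i < k) chi (Cs i))%:R) ^+ d]].

End FreeDimension.

(* Main.v *)
Require Import Defs.
From HB Require Import structures.
From mathcomp Require Import all_boot all_order all_algebra.
From mathcomp Require Import finmap.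
From mathcomp Require Import all_classical all_reals all_analysis.
From mathcomp Require Import zify.

Set Implicit Arguments.
Unset Strict Implicit.
Unset Printing Implicit Defensive.
Import Order.Theory.

(** A finite set F of nodes sorts the points x of a pseudotree according to
    which t in F lie above x; the classes of F are the fibres of [pattern F].
    Adding one more node t to F splits at most two of the existing classes,
    namely the class of the points below no node of F and one further class,
    because any two points below a common node are comparable. Hence F
    determines at most 2 |F| + 1 classes ([size_uniq_pattern]), whereas |F|
    arbitrary sets could determine 2 ^ |F| of them. This linear bound drives
    both parts.

    Free dimension: every element of the initial chain algebra is a union of
    classes of some finite F, so the partitions of the Stone space into the
    clopen sets of these classes are cofinal. The partition attached to the
    union of F_1, ..., F_k refines those attached to the F_i and has at most
    2 (|F_1| + ... + |F_k|) + 1 members; the weight |F| + 1 absorbs the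
    constant.

    Free products: call an element supported by F when it is a union of classes
    of F. If B2 is uncountable, infinitely many elements of B2 have, for one
    fixed N, a support of size at most N. Any infinite family in a Boolean
    algebra contains, for each k, k elements whose values distinguish k + 1
    ultrafilters ([values_uniq]). Applied to these elements of B2, and to
    B1 for 2N + 1 ultrafilters with some support of size m, this gives
    (2N + 1)(k + 1) pairs of ultrafilters. In a free product every pair extends
    to an ultrafilter ([free_product_point]), so these pairs are distinguished
    by points lying in distinct classes of a set of at most m + N k nodes, that
    is (2N + 1)(k + 1) <= 2 (m + N k) + 1. The left side grows faster in k. *)

(** * Ultrafilters of a Boolean algebra *)

Section Ultrafilters.
Context (d : Order.disp_t) (A : ctbDistrLatticeType d).
Implicit Types (x y z : A) (s : seq A) (G U : set A) (u v : stone A).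
Local Open Scope classical_set_scope.
Local Open Scope order_scope.

Definition fip G :=
  forall s, (forall x, x \in s -> G x) -> \meet_(x <- s) x <> \bot.

Lemma fip_setU1N G x : ~ fip (x |` G) ->
  exists2 s, (forall y, y \in s -> G y) & x `&` \meet_(y <- s) y = \bot.
Proof.
move=> /existsNP[s /not_implyP[sG /contrapT s0]].
exists [seq y <- s | y != x] => [y|].
  by rewrite mem_filter => /andP[/eqP yx /sG[]].
apply/eqP; rewrite -lex0 -s0; apply/meetsP_seq => y ys _.
have [->|yx] := eqVneq y x; first exact: leIl.
by apply: leIxr; apply: meets_inf_seq => //; rewrite mem_filter yx.
Qed.

Lemma fip_or_compl G x : fip G -> fip (x |` G) \/ fip (~` x |` G).
Proof.
move=> Gfip; apply: contrapT => /not_orP[].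
move=> /fip_setU1N[s sG s0] /fip_setU1N[t tG t0].
apply: (Gfip (s ++ t)) => [y|].
  by rewrite mem_cat => /orP[/sG|/tG].
rewrite big_cat /=; set m := \meet_(y <- s) y; set n := \meet_(y <- t) y.
rewrite -[LHS]meet1x -(joinxC x) meetUl.
by rewrite meetA s0 meet0x join0x meetCA t0 meetx0.
Qed.

(** By Zorn's lemma the families extending G with the finite intersection
    property have a maximal one, and [fip_or_compl] makes it contain x or its
    complement for each x. This gives both the compactness of the Stone space
    and the existence of enough two-valued homomorphisms. *)
Lemma fip_ultrafilter G : fip G -> exists u, G `<=` val u.
Proof.
move=> Gfip.
have [F Fchain Ftot|M [MP Mmax]] :=
    @Zorn_bigcup _ [set X : set A | fip (G `|` X)].
  (* The set0 alternative covers the empty chain. *)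
  move=> s sGF; have [X [FX sX]] : exists X, (X = set0 \/ F X) /\
      forall x, x \in s -> (G `|` X) x.
    elim: s sGF => [_|a s IHs sGF]; first by exists set0; split; [left|].
    have [x xs|X [FX sX]] := IHs; first by apply: sGF; rewrite inE xs orbT.
    have [Ga|[Y FY Ya]] := sGF a (mem_head _ _).
      exists X; split=> // x; rewrite inE => /orP[/eqP->|/sX //]; by left.
    have [XY|YX] : X `<=` Y \/ Y `<=` X.
    - by case: FX => [->|FX]; [left; exact: sub0set|exact: Ftot].
    - exists Y; split; first by right.
      by move=> x; rewrite inE => /orP[/eqP->|/sX[|/XY]]; [right|left|right].
    - exists X; split=> // x; rewrite inE => /orP[/eqP->|/sX //].
      by right; exact: YX.
  case: FX sX => [->|FX] sX; first by apply: Gfip => x /sX[].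
  exact: (Fchain X FX).
pose U := G `|` M.
have Uclosed x : fip (x |` U) -> U x.
  move=> xU; apply: contrapT => Ux; apply: (Mmax (x |` M)).
    split; first exact: subsetUr.
    by move=> xM; apply: Ux; right; apply: xM; left.
  by rewrite /= setUCA.
have Ucompl x : U x \/ U (~` x).
  by have [/Uclosed|/Uclosed] := fip_or_compl x MP; [left|right].
have Ubot s : (forall x, x \in s -> U x) -> \meet_(x <- s) x <> \bot.
    exact: MP.
have UU : ultrafilter U.
  split.
  - have [//|UC] := Ucompl \top; case: (Ubot [:: ~` \top]).
      by move=> x; rewrite inE => /eqP->.
    by rewrite big_seq1 compl1.
  - move=> U0; case: (Ubot [:: \bot]); last by rewrite big_seq1.
    by move=> x; rewrite inE => /eqP->.
  - move=> x y Ux Uy; have [//|UC] := Ucompl (x `&` y).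
    case: (Ubot [:: x; y; ~` (x `&` y)]).
      by move=> z; rewrite !inE => /or3P[] /eqP->.
    by rewrite !big_cons big_nil meetx1 meetA meetxC.
  - move=> x y xy Ux; have [//|UC] := Ucompl y.
    case: (Ubot [:: x; ~` y]); first by move=> z; rewrite !inE => /orP[] /eqP->.
    rewrite !big_cons big_nil meetx1; apply/eqP.
    by rewrite disj_leC complK.
  - exact: Ucompl.
by exists (exist _ U (mem_set UU)); exact: subsetUl.
Qed.

Lemma stone_bot u : ~ val u \bot.
Proof. by case: (set_mem (valP u)). Qed.

Lemma stone_le u x y : x <= y -> val u x -> val u y.
Proof. by case: (set_mem (valP u)) => _ _ _ + _ => /[apply]. Qed.

Lemma stone_top u : val u \top.
Proof. by case: (set_mem (valP u)). Qed.

Lemma stone_meetE u x y : val u (x `&` y) <-> val u x /\ val u y.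
Proof.
split=> [uxy|[ux uy]]; last by case: (set_mem (valP u)) => _ _ + _ _; exact.
by split; apply: stone_le uxy; [exact: leIl|exact: leIr].
Qed.

Lemma stone_complE u x : val u (~` x) <-> ~ val u x.
Proof.
split=> [ucx ux|]; last by case: (set_mem (valP u)) => _ _ _ _ /(_ x)[].
by apply: (@stone_bot u); rewrite -(meetxC x); exact/stone_meetE.
Qed.

Lemma stone_meetsE u s :
  val u (\meet_(x <- s) x) <-> forall x, x \in s -> val u x.
Proof.
elim: s => [|a s IHs]; first by rewrite big_nil; split=> // _; exact: stone_top.
rewrite big_cons stone_meetE IHs; split=> [[ua us] x|us].
  by rewrite inE => /orP[/eqP->|/us].
by split=> [|x xs]; apply: us; rewrite inE ?eqxx ?xs ?orbT.
Qed.

Definition stone_eval u x : bool := `[< val u x >].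

Lemma stone_evalP u x : reflect (val u x) (stone_eval u x).
Proof. exact: asboolP. Qed.

Lemma stone_eval_compl u x : stone_eval u (~` x) = ~~ stone_eval u x.
Proof.
apply/stone_evalP/idP => [/stone_complE|/negP] ux.
  exact/negP/(contra_not (elimT (stone_evalP u x))).
by apply/stone_complE => /stone_evalP.
Qed.

Lemma stone_eval_meet u : {morph stone_eval u : x y / x `&` y}.
Proof.
move=> x y; apply/stone_evalP/andP => [/stone_meetE[]|[]].
  by split; exact/stone_evalP.
by move=> /stone_evalP ? /stone_evalP ?; exact/stone_meetE.
Qed.

Lemma stone_eval_hom u : boolean_hom (stone_eval u).
Proof.
split; [| |exact: stone_eval_meet| |exact: stone_eval_compl].
- by apply/negP => /stone_evalP/stone_bot.
- exact/stone_evalP/stone_top.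
- move=> x y; rewrite -[x `|` y]complK complU stone_eval_compl stone_eval_meet.
  rewrite !stone_eval_compl.
  by case: (stone_eval u x) (stone_eval u y) => [] [].
Qed.

Lemma stone_of_neq0 x : x <> \bot -> exists u, val u x.
Proof.
move=> x0; have [s sx|u xu] := @fip_ultrafilter [set x];
  last by exists u; exact: xu.
move=> s0; apply: x0; apply/eqP; rewrite -lex0 -s0.
by apply/meetsP_seq => y /sx ->.
Qed.

Lemma stone_separates x y :
  (forall u, stone_eval u x = stone_eval u y) -> x = y.
Proof.
suff le_sep a b : (forall u, stone_eval u a = stone_eval u b) -> a <= b.
  by move=> xy; apply/le_anti; rewrite !le_sep.
move=> ab; rewrite -[b]complK -disj_leC.
apply/negPn/negP => /eqP/stone_of_neq0[u] /stone_meetE[/stone_evalP].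
by rewrite ab => ub /stone_complE/stone_evalP; rewrite ub.
Qed.

End Ultrafilters.

(** * Sequences with distinct images *)

Lemma uniq_map_inj (T1 T2 : eqType) (f : T1 -> T2) (s : seq T1) :
  uniq (map f s) -> {in s &, injective f}.
Proof.
elim: s => [|a s IHs] //= /andP[fas /IHs sinj] x y.
rewrite !inE => /predU1P[->|xs] /predU1P[->|ys] // fxy; last exact: sinj.
- by rewrite fxy map_f in fas.
- by rewrite -fxy map_f in fas.
Qed.

Lemma size_uniq_const (T1 T2 : eqType) (f : T1 -> T2) (s : seq T1) :
  uniq (map f s) -> {in s &, forall x y, f x = f y} -> size s <= 1.
Proof.
case: s => [|a [|b s]] //= /andP[+ _] fs; rewrite (fs a b) ?inE ?eqxx ?orbT//.
Qed.

(** * Finite families that distinguish many ultrafilters *)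

Section SeparatedUltrafilters.
Context (d : Order.disp_t) (B : ctbDistrLatticeType d).
Implicit Types (s : seq B) (u v : stone B).
Local Open Scope classical_set_scope.

Definition values s u := [seq stone_eval u b | b <- s].

Lemma eq_valuesP s u v :
  values s u = values s v <-> {in s, stone_eval u =1 stone_eval v}.
Proof. by split => [/eq_in_map|?]; last exact/eq_in_map. Qed.

(** If elements of Q never separated ultrafilters agreeing on s, each b in Q
    would be determined by the set of value sequences on s of the ultrafilters
    containing b, and there are finitely many such sets. *)
Lemma values_split (Q : set B) s : infinite_set Q ->
  exists b u v, [/\ Q b, values s u = values s v &
    stone_eval u b != stone_eval v b].
Proof.
move=> Qinf; apply: contrapT => nsplit; apply: Qinf.
have {}nsplit b u v : Q b -> values s u = values s v ->
    stone_eval u b = stone_eval v b.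
  move=> Qb uv; apply/eqP/negPn/negP => buv.
  by apply: nsplit; exists b, u, v; split.
pose D b := [set t : (size s).-tuple bool |
  `[< exists2 u, values s u = t & stone_eval u b >]]%SET.
suff Dinj : {in Q &, injective D}.
  by rewrite -(eq_finite_set (inj_card_eq Dinj)); exact: finite_finset.
move=> b c /set_mem Qb /set_mem Qc Dbc.
have D_sub a a' u : D a = D a' -> Q a' -> stone_eval u a -> stone_eval u a'.
  move=> Daa' Qa' ua.
  have sz : size (values s u) == size s by rewrite size_map.
  have : Tuple sz \in D a by rewrite inE; apply/asboolP; exists u.
  rewrite Daa' inE => /asboolP[v /= vu va'].
  by rewrite -(nsplit a' v u).
apply: stone_separates => u; apply/idP/idP; exact: D_sub.
Qed.

(** The element b given by [values_split] separates two ultrafilters u, v with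
    equal values on s. Only one of the two can share its values on b :: s with a
    listed ultrafilter, since the listed ones already differ on s; the other one
    joins the list. *)
Lemma values_uniq (Q : set B) k : infinite_set Q ->
  exists s (us : seq (stone B)), [/\ size s = k, forall b, b \in s -> Q b,
    size us = k.+1 & uniq [seq values s u | u <- us]].
Proof.
move=> Qinf; elim: k => [|k [s [us [ss sQ sus usuniq]]]].
  have [b [u _]] := values_split [::] Qinf.
  by exists [::], [:: u]; split.
have [b [u [v [Qb uv buv]]]] := values_split s Qinf.
have usinj : {in us &, injective (values s)}.
  exact: uniq_map_inj.
pose used w := values (b :: s) w \in [seq values (b :: s) w | w <- us].
have [w wus] : exists w, ~~ used w.
  have [uus|] := boolP (used u); last by exists u.
  exists v; apply/negP => /mapP[v' v'us [bv vv']].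
  have /mapP[u' u'us [bu uu']] := uus.
  have uv' : u' = v' by apply: usinj => //; rewrite -uu' -vv'.
  by move: buv; rewrite bu bv uv' eqxx.
exists (b :: s), (w :: us); split=> //=; [by rewrite ss| |by rewrite sus|].
- by move=> c; rewrite inE => /orP[/eqP->|/sQ].
- rewrite -/(values _ _) wus map_inj_in_uniq ?(map_uniq usuniq)//.
  by move=> x y xus yus [_]; exact: usinj.
Qed.

End SeparatedUltrafilters.

(** * Classes of points below a finite set of nodes *)

Section OrderPatterns.
Context (dT : Order.disp_t) (T : porderType dT).
Implicit Types (x y t : T) (F G : seq T) (X Y : set T).

Definition pattern F x := [seq (x <= t)%O | t <- F].

Lemma eq_patternP F x y :
  pattern F x = pattern F y <-> {in F, forall t, (x <= t)%O = (y <= t)%O}.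
Proof. by split => [/eq_in_map|?]; last exact/eq_in_map. Qed.

Lemma sub_pattern F G x y : {subset F <= G} ->
  pattern G x = pattern G y -> pattern F x = pattern F y.
Proof. by move=> FG /eq_patternP xy; apply/eq_patternP => t /FG; exact: xy. Qed.

(** Let r in F lie above x', hence above x and above y, which shares the class
    of x. Then y and x' are comparable, and y <= x' would put y below t. So
    every node of F above x, being above y, is above x'. *)
Lemma split_pattern F t x x' y : pseudotree T ->
  (x <= x')%O -> (x' <= t)%O -> ~~ (y <= t)%O ->
  pattern F x = pattern F y -> true \in pattern F x' ->
  pattern F x = pattern F x'.
Proof.
move=> hT xx' x't yt /eq_patternP xy /mapP[r rF x'r].
apply/eq_patternP => q qF; apply/idP/idP => [xq|]; last exact: le_trans.
have yr : (y <= r)%O by rewrite -xy// (le_trans xx').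
have /orP[x'y|yx'] := hT _ _ _ (esym x'r) yr.
  by rewrite (le_trans x'y)// -xy.
by rewrite (le_trans yx' x't) in yt.
Qed.

(** Adding t to F creates as many new classes as there are classes of F with
    members on both sides of t. By [split_pattern] at most one of these lies
    below some node of F, and all points below no node of F form a single
    class. *)
Lemma size_uniq_pattern F s : pseudotree T ->
  uniq [seq pattern F x | x <- s] -> size s <= (size F).*2.+1.
Proof.
move=> hT; elim: F s => [|t F IHF] s us; first exact: size_uniq_const us _.
have sinj := uniq_map_inj us.
pose s1 := [seq x <- s | (x <= t)%O]; pose s2 := [seq x <- s | ~~ (x <= t)%O].
have uniq_on_side (r : seq T) b : {subset r <= s} -> uniq r ->
    {in r, forall x, (x <= t)%O = b} -> uniq [seq pattern F x | x <- r].
  move=> rs ur rt; rewrite map_inj_in_uniq// => x y xr yr xy.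
  by apply: sinj; rewrite ?rs//= (rt x)// (rt y)// -/(pattern F x) xy.
have us0 := map_uniq us.
have us1 : uniq [seq pattern F x | x <- s1].
  apply: (uniq_on_side _ true); [exact: mem_subseq (filter_subseq _ _)|
    exact: filter_uniq|by move=> x; rewrite mem_filter => /andP[]].
have us2 : uniq [seq pattern F x | x <- s2].
  apply: (uniq_on_side _ false); [exact: mem_subseq (filter_subseq _ _)|
    exact: filter_uniq|by move=> x; rewrite mem_filter => /andP[/negbTE]].
pose old := [pred x | pattern F x \in [seq pattern F y | y <- s1]].
pose r := [seq x <- s2 | old x]; pose r' := [seq x <- s2 | ~~ old x].
have size_s : size s = size (s1 ++ r') + size r.
  rewrite size_cat -[LHS](count_predC (fun x => (x <= t)%O)) -!size_filter.
  by rewrite -addnA addnC -[in RHS](addnC (size r)) (size_filter old)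
    (size_filter (predC old)) count_predC addnC.
have u' : uniq [seq pattern F x | x <- s1 ++ r'].
  rewrite map_cat cat_uniq us1 (subseq_uniq _ us2) ?map_subseq ?filter_subseq//.
  rewrite andbT; apply/hasPn => _ /mapP[x + ->].
  by rewrite mem_filter => /andP[].
(* [s1 ++ r'] has one point in each class of F met by s, and r one point in each
   class of F that s meets on both sides of t. *)
suff : size r <= 2 by have := IHF _ u'; rewrite size_s /= doubleS; lia.
rewrite -(count_predC (fun x => true \in pattern F x)) -!size_filter.
have ur : uniq [seq pattern F x | x <- r].
  by rewrite (subseq_uniq _ us2) ?map_subseq ?filter_subseq.
rewrite -[2]/(1 + 1) leq_add//.
- apply: (@size_uniq_const _ _ (pattern F)).
    by rewrite (subseq_uniq _ ur) ?map_subseq ?filter_subseq.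
  move=> y y'; rewrite !mem_filter /= => /and4P[yF /mapP[x + yx] yt _].
  rewrite mem_filter => /andP[xt _] /and4P[y'F /mapP[x' + y'x'] y't _].
  rewrite mem_filter => /andP[x't _]; rewrite yx y'x'.
  have /orP[xx'|x'x] := hT _ _ _ xt x't.
    by apply: split_pattern hT xx' x't yt (esym yx) _; rewrite -y'x'.
  by apply/esym/(split_pattern hT x'x xt y't (esym y'x')); rewrite -yx.
- apply: (@size_uniq_const _ _ (pattern F)).
    by rewrite (subseq_uniq _ ur) ?map_subseq ?filter_subseq.
  have patternF y :
      true \notin pattern F y -> pattern F y = nseq (size F) false.
    move=> yF; rewrite -(size_map (fun t => (y <= t)%O) F).
    apply/all_pred1P/allP => b bF /=.
    by move: bF yF; case: b => // ->.
  move=> y y'; rewrite !mem_filter.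
  by move=> /andP[/patternF-> _] /andP[/patternF-> _].
Qed.

(** A longest sequence of points in distinct classes meets every class. *)
Lemma pattern_reps F : pseudotree T -> exists r : seq T,
  size r <= (size F).*2.+1 /\
  forall x, exists2 y, y \in r & pattern F y = pattern F x.
Proof.
move=> hT.
pose P n := `[< exists2 r, size r = n & uniq [seq pattern F x | x <- r] >].
have P0 : exists n, P n by exists 0; apply/asboolP; exists [::].
have Pmax n : P n -> n <= (size F).*2.+1.
  by move=> /asboolP[r <-]; exact: size_uniq_pattern.
case: (ex_maxnP P0 Pmax) => n /asboolP[r rn ur] nmax.
exists r; split=> [|x]; first exact: size_uniq_pattern.
have [/mapP[y yr xy]|xr] :=
  boolP (pattern F x \in [seq pattern F y | y <- r]).
  by exists y.
suff : P n.+1 by move=> /nmax; rewrite ltnn.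
by apply/asboolP; exists (x :: r); rewrite /= ?rn// xr.
Qed.

(** X is a union of classes of F. *)
Definition supported F X := forall x y, pattern F x = pattern F y -> X x -> X y.

Lemma sub_supported F G X :
  {subset F <= G} -> supported F X -> supported G X.
Proof. by move=> FG FX x y /(sub_pattern FG); exact: FX. Qed.

Lemma ica_supported X : initial_chain_sets X -> exists F, supported F X.
Proof.
move=> /(_ [set Y | exists F, supported F Y]%classic); apply.
split; last first.
  move=> _ [t _ <-]; exists [:: t] => x y [xy] /=.
  by rewrite /initial_chain /= xy.
split=> [|Y [F FY]|Y Z [F FY] [G GZ]].
- by exists [::].
- by exists F => x y xy Yx /(FY _ _ (esym xy)).
- exists (F ++ G) => x y xy [/FY Yy|/GZ Zy]; [left|right].
    by apply/Yy/(sub_pattern _ xy) => t; rewrite mem_cat => ->.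
  by apply/Zy/(sub_pattern _ xy) => t; rewrite mem_cat orbC => ->.
Qed.

Definition cell F x : set T := [set y | pattern F y = pattern F x].

Lemma ica_cell F x : initial_chain_sets (cell F x).
Proof.
have [ica0 icaC icaU] := set_algebra_initial_chain_sets T.
have icaI X Y : initial_chain_sets X -> initial_chain_sets Y ->
    initial_chain_sets (X `&` Y)%classic.
  by move=> iX iY; rewrite -[(_ `&` _)%classic]setCK setCI;
  exact: (icaC _ (icaU _ _ (icaC _ iX) (icaC _ iY))).
elim: F => [|t F IHF].
  rewrite (_ : cell _ _ = setT) -?setC0; first exact: (icaC _ ica0).
  by apply/seteqP; split=> // y _; rewrite /cell.
pose X : set T :=
  if (x <= t)%O then initial_chain t else (~` initial_chain t)%classic.
have iX : initial_chain_sets X.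
  have it : initial_chain_sets (initial_chain t).
    by move=> G [_]; apply; exists t.
  by rewrite /X; case: ifP => _ //; exact: (icaC _ it).
have XE y : X y <-> (y <= t)%O = (x <= t)%O.
  rewrite /X; case: ifP => xt; first by [].
  by split => [/negP/negbTE //|yt] /=; rewrite /initial_chain /= yt.
rewrite (_ : cell _ _ = (X `&` cell F x)%classic);
  first exact: (icaI _ _ iX IHF).
apply/seteqP; split=> y.
  by move=> [yt yx]; split=> //; exact/XE.
by move=> [/XE yt yx]; rewrite /cell /= yt; congr (_ :: _).
Qed.

End OrderPatterns.

(** * The Stone space of the initial chain algebra *)

Lemma card_fset_set_seq (K : choiceType) (l : seq K) :
  #|` fset_set [set` l]%classic| <= size l.
Proof.
have -> : [set` l]%classic = [set` seq_fset tt l]%classic.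
  by apply/seteqP; split=> x; rewrite /mkset seq_fsetE.
by rewrite set_fsetK size_seq_fset size_undup.
Qed.

Lemma open_stone_clopen (d : Order.disp_t) (A : ctbDistrLatticeType d) (a : A) :
  open (stone_clopen a).
Proof.
exists [set stone_clopen a]%classic; last by rewrite bigcup_set1.
by move=> _ ->; exists a.
Qed.

Lemma closed_stone_clopen (d : Order.disp_t) (A : ctbDistrLatticeType d)
    (a : A) :
  closed (stone_clopen a).
Proof.
rewrite -[stone_clopen a]setCK; apply: open_closedC.
rewrite (_ : (~` _)%classic = stone_clopen (~` a)%O);
  first exact: open_stone_clopen.
by apply/seteqP; split=> u /stone_complE.
Qed.

Lemma stone_clopen_base (d : Order.disp_t) (A : ctbDistrLatticeType d)
    (V : set (stone A)) (u : stone A) : open V -> V u ->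
  exists2 a, stone_clopen a u & (stone_clopen a `<=` V)%classic.
Proof.
move=> [D DA <-] [X DX Xu]; have [a _ aX] := DA _ DX.
by exists a; rewrite aX// => v Xv; exists X.
Qed.

Section StoneCovers.
Context (dT : Order.disp_t) (T : porderType dT).
Implicit Types (x y : T) (F G : seq T) (a b : initial_chain_algebra T).

Lemma ica_meetsE (I : eqType) (s : seq I) (g : I -> initial_chain_algebra T) x :
  val (\meet_(i <- s) g i)%O x <-> forall i, i \in s -> val (g i) x.
Proof.
elim: s => [|i s IHs]; first by rewrite big_nil.
rewrite big_cons; split=> [[gix /IHs gsx] j|gx].
  by rewrite inE => /orP[/eqP->|/gsx].
split; first by apply: gx; rewrite mem_head.
by apply/IHs => j js; apply: gx; rewrite inE js orbT.
Qed.

Lemma ica_point a : a <> \bot%O -> exists x, val a x.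
Proof.
move=> a0; apply: contrapT => /forallNP ax; apply: a0; apply: val_inj.
by apply/seteqP; split=> // x /ax.
Qed.

Lemma ica_le a b : (forall x, val a x -> val b x) -> (a <= b)%O.
Proof.
move=> ab; rewrite -[b]complK -disj_leC; apply/negPn/negP => /eqP/ica_point[x].
by case=> /ab bx; exact.
Qed.

Lemma ica_seq_supported (s : seq (initial_chain_algebra T)) :
  exists F, forall a, a \in s -> supported F (val a).
Proof.
elim: s => [|b s [F Fs]]; first by exists [::].
have [G Gb] := ica_supported (set_mem (valP b)).
exists (G ++ F) => a; rewrite inE => /predU1P[->|/Fs].
  by apply: sub_supported Gb => t; rewrite mem_cat => ->.
by apply: sub_supported => t; rewrite mem_cat orbC => ->.
Qed.

Definition cell_elt F x : initial_chain_algebra T :=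
  exist _ (cell F x) (mem_set (ica_cell F x)).

Definition cell_cover F : set (set (stone (initial_chain_algebra T))) :=
  range (fun x => stone_clopen (cell_elt F x)).

Lemma eq_cell_elt F x y :
  pattern F x = pattern F y -> cell_elt F x = cell_elt F y.
Proof. by move=> xy; apply: val_inj; rewrite /= /cell xy. Qed.

Lemma cell_cover_seq F : pseudotree T ->
  exists2 l, size l <= (size F).*2.+1 & cell_cover F = [set` l]%classic.
Proof.
move=> hT; have [r [rF rE]] := pattern_reps F hT.
exists [seq stone_clopen (cell_elt F x) | x <- r]; first by rewrite size_map.
apply/seteqP; split=> [_ [x _ <-]|_ /mapP[x _ ->]]; last by exists x.
by have [y yr /eq_cell_elt <-] := rE x; apply/mapP; exists y.
Qed.

(** The finitely many cells of F cover the tree, so their complements have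
    empty meet and an ultrafilter cannot contain all of these. *)
Lemma stone_in_cell F (u : stone (initial_chain_algebra T)) : pseudotree T ->
  exists x, val u (cell_elt F x).
Proof.
move=> hT; have [r [_ rE]] := pattern_reps F hT.
apply: contrapT => /forallNP ncell.
have : val u (\meet_(b <- [seq ~` cell_elt F x | x <- r]) b)%O.
  by apply/stone_meetsE => _ /mapP[x _ ->]; exact/stone_complE.
apply: contraPnot (@stone_bot _ _ u) => um; rewrite notK; apply: stone_le um.
apply: ica_le => x; rewrite big_map => /ica_meetsE xr.
by have [y yr yx] := rE x; case: (xr y yr); exact: esym.
Qed.

Lemma cell_cover_FCC F : pseudotree T -> FCC (cell_cover F).
Proof.
move=> hT; split.
- by have [l _ ->] := cell_cover_seq F hT; exact: finite_seq.
- rewrite -subTset => u _; have [x ux] := stone_in_cell F u hT.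
  by exists (stone_clopen (cell_elt F x)) => //; exists x.
- by move=> _ [x _ <-]; exact: closed_stone_clopen.
Qed.

Lemma cell_cover_refines F G : {subset F <= G} ->
  refines (cell_cover G) (cell_cover F).
Proof.
move=> FG _ [x _ <-]; exists (stone_clopen (cell_elt F x)); first by exists x.
by move=> u; apply: stone_le; apply: ica_le => y /= /(sub_pattern FG).
Qed.

(** Call a small when its clopen set lies in a member of U. By compactness, the
    elements that are complements of small ones lack the finite intersection
    property, so finitely many small elements cover the tree. A finite F
    supporting all of these has each of its cells inside one of them. *)
Lemma cell_cover_cofinal : pseudotree T ->
  topologically_cofinal [set C | exists F, C = cell_cover F]%classic.
Proof.
move=> hT; split=> [_ [F ->]|U [Uopen UT]]; first exact: cell_cover_FCC.
pose small a := exists2 V, U V & (stone_clopen a `<=` V)%classic.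
have [/fip_ultrafilter[u uG]|] :=
  pselect (fip [set a | small (~` a)%O]%classic).
  have [V UV Vu] : (\bigcup_(V in U) V)%classic u by rewrite UT.
  have [a ua aV] := stone_clopen_base (Uopen _ UV) Vu.
  suff /uG : small (~` ~` a)%O by move=> /stone_complE.
  by rewrite complK; exists V.
move=> /existsNP[s /not_implyP[ssmall /contrapT s0]].
have [F Fs] := ica_seq_supported s.
exists (cell_cover F) => [|_ [x _ <-]]; first by exists F.
have [a as_ ax] : exists2 a, a \in s & ~ val a x.
  apply: contrapT => /forall2NP ns.
  suff : val (\meet_(a <- s) a)%O x by rewrite s0.
  apply/ica_meetsE => a as_; have [//|] := ns a; exact: contrapT.
have [V UV aV] := ssmall a as_; exists V => // u ux; apply: aV.
apply: stone_le ux; apply: ica_le => y /= yx ay; apply: ax.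
exact: (Fs a as_ y x yx).
Qed.

Lemma free_dim_ica (R : realType) : pseudotree T ->
  free_dim_le (stone (initial_chain_algebra T)) R 1.
Proof.
move=> hT.
(* Different F may give the same cover, while the weight depends on the cover
   alone: one F is chosen for each cover. *)
have /choice[supp suppE] (C : set (set (stone (initial_chain_algebra T)))) :
    exists F, (exists G, C = cell_cover G) -> C = cell_cover F.
  by have [[F ->]|nC] := pselect (exists F, C = cell_cover F);
    [exists F|exists [::]].
exists [set C | exists F, C = cell_cover F]%classic, 2%:R%R,
  (fun C => (size (supp C)).+1).
split=> [||k Cs k0 CsE]; first exact: cell_cover_cofinal.
  by rewrite Num.Theory.ltr0n.
pose F := flatten [seq supp (Cs i) | i <- enum 'I_k].
have [l lF FE] := cell_cover_seq F hT.
exists (cell_cover F); split=> [|i|]; first exact: cell_cover_FCC.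
  rewrite (suppE _ (CsE i)); apply: cell_cover_refines => t ti.
  by apply/flattenP; exists (supp (Cs i)) => //; rewrite map_f// mem_enum.
rewrite GRing.expr1 -GRing.natrM Num.Theory.ler_nat FE.
apply: (leq_trans (card_fset_set_seq l)); apply: (leq_trans lF).
have -> : size F = \sum_(i < k) size (supp (Cs i)).
  by rewrite size_flatten sumnE /shape !big_map.
under [in leqRHS]eq_bigr do rewrite -addn1.
rewrite big_split /= sum_nat_const card_ord muln1; lia.
Qed.

End StoneCovers.

(** * Free products inside the initial chain algebra *)

(** The ultrafilters u and v are two-valued homomorphisms, which the free
    product extends to a single one h on P. A finite meet of elements with value
    1 under h is nonzero, so its image under the injective f contains a point,
    at which membership reproduces the values of u on s1 and of v on s2. *)
Lemma free_product_point (dT d1 d2 dP : Order.disp_t) (T : porderType dT)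
    (B1 : ctbDistrLatticeType d1) (B2 : ctbDistrLatticeType d2)
    (P : ctbDistrLatticeType dP) (i1 : B1 -> P) (i2 : B2 -> P)
    (f : P -> initial_chain_algebra T) (s1 : seq B1) (s2 : seq B2)
    (u : stone B1) (v : stone B2) :
  is_free_product i1 i2 -> boolean_hom f -> injective f ->
  exists x : T,
    (forall b, b \in s1 -> stone_eval u b = `[< val (f (i1 b)) x >]) /\
    (forall b, b \in s2 -> stone_eval v b = `[< val (f (i2 b)) x >]).
Proof.
move=> [_ _ free] [f0 f1 fI _ fC] finj.
have [h [[[h0 h1 hI _ hC] hu hv] _]] :=
  free _ _ _ _ (stone_eval_hom u) (stone_eval_hom v).
pose s := [seq i1 b | b <- s1] ++ [seq i2 b | b <- s2].
pose lit z : P := if h z then z else (~` z)%O.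
have hlit z : h (lit z) = true.
  by rewrite /lit; case hz : (h z); rewrite ?hC ?hz.
have hm : h (\meet_(z <- s) lit z)%O.
  rewrite (big_morph h hI h1) big1//.
have [x] : exists x, val (f (\meet_(z <- s) lit z)%O) x.
  by apply: ica_point; rewrite -f0 => /finj m0; rewrite m0 h0 in hm.
rewrite (big_morph f fI f1) => /ica_meetsE xs.
have hx z : z \in s -> h z = `[< val (f z) x >].
  move=> /xs; rewrite /lit; case: (h z) => zx; apply/esym.
    exact/asboolP.
  by apply/asboolP; move: zx; rewrite fC.
exists x; split=> b bs; rewrite -hx ?mem_cat ?map_f ?orbT//.
  by rewrite -[RHS]/((h \o i1) b) hu.
by rewrite -[RHS]/((h \o i2) b) hv.
Qed.

Lemma seq_supported (dT : Order.disp_t) (T : porderType dT) (I : eqType)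
    (X : I -> set T) (N : nat) (s : seq I) :
  (forall i, i \in s -> exists2 F, size F <= N & supported F (X i)) ->
  exists2 F, size F <= N * size s & forall i, i \in s -> supported F (X i).
Proof.
elim: s => [|i s IHs] sN; first by exists [::].
have [|F Fs Fsupp] := IHs; first by move=> j js; apply: sN; rewrite inE js orbT.
have [G GN Gi] := sN i (mem_head _ _).
exists (G ++ F) => [|j]; first by rewrite size_cat mulnS leq_add.
rewrite inE => /predU1P[->|/Fsupp].
  by apply: sub_supported Gi => t; rewrite mem_cat => ->.
by apply: sub_supported => t; rewrite mem_cat orbC => ->.
Qed.

Lemma uncountable_layer (U : Type) (c : nat -> set U) :
  ~ countable [set: U] -> (forall b, exists n, c n b) ->
  exists n, infinite_set (c n).
Proof.
move=> Unct cT; apply: contrapT => /forallNP cfin; apply: Unct.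
rewrite (_ : [set: U]%classic = \bigcup_n c n)%classic; last first.
  by apply/seteqP; split=> // b _; have [n cb] := cT b; exists n.
apply: bigcup_countable => // n _; apply: finite_set_countable.
exact: contrapT.
Qed.

(** The points realizing pairs of ultrafilters lie in distinct classes, and the
    number of pairs outgrows the linear bound on the number of classes. *)
Lemma ica_no_free_product (dT d1 d2 dP : Order.disp_t) (T : porderType dT)
    (B1 : ctbDistrLatticeType d1) (B2 : ctbDistrLatticeType d2)
    (P : ctbDistrLatticeType dP) (i1 : B1 -> P) (i2 : B2 -> P)
    (f : P -> initial_chain_algebra T) : pseudotree T ->
  infinite_set [set: B1] -> ~ countable [set: B2] -> is_free_product i1 i2 ->
  boolean_hom f -> ~ injective f.
Proof.
move=> hT B1inf B2unct free fhom finj.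
pose X1 b : set T := val (f (i1 b)); pose X2 b : set T := val (f (i2 b)).
have [b|N Ninf] := @uncountable_layer _
    (fun n => [set b | exists2 F, size F <= n & supported F (X2 b)]%classic)
    B2unct.
  have [F Fb] := ica_supported (set_mem (valP (f (i2 b)))).
  by exists (size F), F.
(* If s1 is supported by m nodes, 2m + 2 ultrafilters of B2 are enough:
   (2N + 1)(2m + 2) > 2 (m + N (2m + 1)) + 1. *)
have [s1 [us1 [_ _ sus1 us1uniq]]] := values_uniq N.*2 B1inf.
have [F1 F1s1] : exists F, forall b, b \in s1 -> supported F (X1 b).
  have [F FE] := ica_seq_supported [seq f (i1 b) | b <- s1].
  by exists F => b bs; apply: FE; exact: map_f.
have [s2 [us2 [ss2 s2N sus2 us2uniq]]] := values_uniq (size F1).*2.+1 Ninf.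
have [F2 F2size F2s2] := seq_supported s2N.
have /choice[pt ptE] (uv : stone B1 * stone B2) :=
  free_product_point s1 s2 uv.1 uv.2 free fhom finj.
pose s := [seq pt (u, v) | u <- us1, v <- us2].
pose F := F1 ++ F2.
have eval_eq (I : eqType) (X : I -> set T) i x y :
    supported F (X i) -> pattern F x = pattern F y ->
    `[< X i x >] = `[< X i y >].
  by move=> FX xy; apply/asboolP/asboolP; exact: FX.
have suniq : uniq [seq pattern F x | x <- s].
  rewrite map_allpairs.
  apply: allpairs_uniq (map_uniq us1uniq) (map_uniq us2uniq) _.
  move=> [u v] [u' v'] /allpairsP[[a b] [/= aus bus [-> ->]]].
  move=> /allpairsP[[a' b'] [/= aus' bus' [-> ->]]] ab.
  have [pu pv] := ptE (a, b); have [pu' pv'] := ptE (a', b').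
  congr (_, _).
    apply: (uniq_map_inj us1uniq) => //; apply/eq_valuesP => c cs.
    rewrite pu// pu'//; apply: (eval_eq _ X1) ab.
    by apply: sub_supported (F1s1 c cs) => t; rewrite mem_cat => ->.
  apply: (uniq_map_inj us2uniq) => //; apply/eq_valuesP => c cs.
  rewrite pv// pv'//; apply: (eval_eq _ X2) ab.
  by apply: sub_supported (F2s2 c cs) => t; rewrite mem_cat orbC => ->.
move: F2size (size_uniq_pattern hT suniq).
rewrite size_allpairs sus1 sus2 ss2 size_cat -!muln2.
move: (size F1) (size F2) => m n; nia.
Qed.

Theorem corollary4p7 (R : realType) (dT : Order.disp_t) (T : porderType dT)
    (hT : pseudotree T) :
  free_dim_le (stone (initial_chain_algebra T)) R 1 /\
  (forall (d1 d2 dP : Order.disp_t) (B1 : ctbDistrLatticeType d1)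
          (B2 : ctbDistrLatticeType d2) (P : ctbDistrLatticeType dP)
          (i1 : B1 -> P) (i2 : B2 -> P),
     infinite_set [set: B1] -> ~ countable [set: B2] ->
     is_free_product i1 i2 ->
     ~ exists S : set (initial_chain_algebra T),
         subalgebra S /\ isomorphic_to_subalgebra P S).
Proof.
split; first exact: free_dim_ica.
move=> d1 d2 dP B1 B2 P i1 i2 B1inf B2unct free [S [_ [f [fhom [_ finj _]]]]].
apply: (ica_no_free_product hT B1inf B2unct free fhom) => x y.
by apply: finj; exact: in_setT.
Qed.
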